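(* In the setting of the context (a weighted genus two admissible cover over the standard log point, with associated function $\lambda$), suppose that $\Delta^\circ=\{\lambda>0\}$ is connected of genus two. If there is only one vertex of positive weight on the boundary of $\Delta_T^\circ=\{\lambda_T>0\}\subseteq\Gamma_T$, then it is the special one, i.e. it is the vertex supporting the divisor $D$.
   Context: *Admissible cover.* Over $\mathbb C$, let $\psi\colon(C,D_R)\to(T,D_B)$ be a hyperelliptic admissible cover: a finite degree two morphism of nodal curves, $C$ connected of arithmetic genus $2$, $T$ of genus $0$, étale on $C^{sm}\setminus D_R$, simply ramified along the six smooth points $D_R$ mapping to six distinct smooth points $D_B$, mapping nodes to nodes with the same ramification order $1$ or $2$ on both branches. It carries a weight $w\colon V(\Gamma)\to\mathbb N$ on the dual graph of $C$, not identically zero, such that with $w_T(v)=\sum_{v'\mapsto v}w(v')$ (the weight of a vertex of $\Gamma_T$) every component of $T$ with $w_T=0$ has at least three nodes or branch points. *Metric.* $\Gamma=\mathrm{trop}(C)$ and the tree $\Gamma_T=\mathrm{trop}(T)$ are the dual graphs with positive real edge lengths, where the length of an edge of $\Gamma_T$ is the ramification order (expansion factor) times the length of any edge of $\Gamma$ above it; $\mathrm{trop}(\psi)\colon\Gamma\to\Gamma_T$ is the induced harmonic map of degree two. For a subcurve, genus means arithmetic genus: first Betti number plus sum of vertex genera. *Functions.* A piecewise linear (PL) function has integral slopes on (a subdivision of) $\Gamma$ (half-integral slopes allowed on $\Gamma_T$); $\mathrm{div}(\lambda)(v)$ is the sum of outgoing slopes at $v$; $K_\Gamma(v)=2g(v)-2+\mathrm{val}(v)$.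 Pullback along $\mathrm{trop}(\psi)$ composes functions and multiplies divisors by local degrees. On $\Gamma_T$ let $D'(v)=\mathrm{val}(v)-2+\tfrac12\deg(D_B|_v)$ (valence counts edges only); it has degree $1$ and pulls back to $K_\Gamma$. For each vertex $v_0$ of $\Gamma_T$ there is a PL function $\overline\lambda_T$, unique up to constants, with $D'+\mathrm{div}(\overline\lambda_T)=v_0$; its pullback to $\Gamma$ is an *admissible function*. Let $\overline\lambda_1,\dots,\overline\lambda_s$ be all of them and let $\lambda_i$ be $\overline\lambda_i$ shifted by a constant so that vertices with $\lambda_i>0$ have weight $0$ while those with $\lambda_i\ge0$ have total weight $\ge1$ (i.e. the maximum of $\lambda_i$ on vertices of positive weight is $0$). Define $\lambda=\max\{0,\lambda_1,\dots,\lambda_s\}$, a PL function on a subdivision of $\Gamma$, pulled back from $\lambda_T$ on $\Gamma_T$. Put $\Delta^\circ=\{\lambda>0\}$ and let $\Delta$ be the minimal subcurve of genus two containing the closure of $\Delta^\circ$, $\Delta_T$ its image in $\Gamma_T$. With $D'$ computed using valences in $\Delta_T$, $D=D'+\mathrm{div}(\lambda_T)$ is an effective divisor of degree $1$ with half-integral coefficients on $\Delta_T$ and $\mathrm{trop}(\psi)^*D=K_\Delta+\mathrm{div}(\lambda)$ on $\Delta$. The point(s) supporting $D$ are called special.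
   Formalization: In D' on Δ_T, each ramified edge cut off by passing to Δ counts as an extra branch point besides D_B; with D_B alone D can be negative and of degree below 1, contradicting the stated pullback to K_Δ + div(λ). *)

(* Defs.v *)
From HB Require Import structures.
From mathcomp Require Import all_boot all_order all_algebra.
From mathcomp Require Import reals.

Set Implicit Arguments.
Unset Strict Implicit.
Unset Printing Implicit Defensive.

Import Order.TTheory GRing.Theory Num.Theory.
Local Open Scope ring_scope.

(* The orientation of the edges (src, tgt) is auxiliary: every notion below is
   invariant under reversing edges. *)
Record mgraph (R : realType) := MGraph {
  vert : finType;
  edge : finType;
  src : edge -> vert;
  tgt : edge -> vert;
  len : edge -> R;
  len_gt0 : forall e, 0 < len e
}.

Section MetricGraph.
Variables (R : realType) (G : mgraph R).
Implicit Types (S : {set vert G}) (A : {set edge G}) (f : vert G -> R).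

Definition induced S : {set edge G} :=
  [set e | (src e \in S) && (tgt e \in S)].

Definition joins (e : edge G) (x y : vert G) : bool :=
  ((src e == x) && (tgt e == y)) || ((src e == y) && (tgt e == x)).

Definition adj S : rel (vert G) :=
  [rel x y | [&& x \in S, y \in S & [exists e, joins e x y]]].

Definition ncomp S : nat := n_comp (adj S) (mem S).

Definition connected S : Prop := ncomp S = 1%N.

Definition betti1 S : int := #|induced S|%:Z - #|S|%:Z + (ncomp S)%:Z.

Definition arith_genus (g : vert G -> nat) S : int :=
  betti1 S + (\sum_(v in S) g v)%N%:Z.

Definition valence A (v : vert G) : nat :=
  (#|[set e in A | src e == v]| + #|[set e in A | tgt e == v]|)%N.

(* A function on the vertices stands for its extension which is linear on each
   edge; diverg A f is its divisor on the subgraph with edges A. *)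
Definition diverg A f (v : vert G) : R :=
  \sum_(e in A | src e == v) (f (tgt e) - f v) / len e +
  \sum_(e in A | tgt e == v) (f (src e) - f v) / len e.

Definition half_integral_slopes f : Prop :=
  forall e : edge G, exists k : int,
    (f (tgt e) - f (src e)) / len e = k%:~R / 2.

End MetricGraph.

(* Tropicalization of a weighted cover psi : (C, D_R) -> (T, D_B), on a model
   of Gamma -> Gamma_T which may be subdivided: orig is the set of vertices of
   Gamma_T which are components of T, the other vertices being interior points
   of edges of trop(T). *)
Record cover_data (R : realType) := CoverData {
  Gam : mgraph R;
  GamT : mgraph R;
  phiV : vert Gam -> vert GamT;
  phiE : edge Gam -> edge GamT;
  ord : edge Gam -> nat;     (* ramification order at the node *)
  ldeg : vert Gam -> nat;    (* degree of psi on the component *)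
  gen : vert Gam -> nat;
  ram : vert Gam -> nat;     (* deg (D_R|_v) *)
  br : vert GamT -> nat;     (* deg (D_B|_v) *)
  wt : vert Gam -> nat;
  orig : {set vert GamT}
}.

Section Cover.
Variables (R : realType) (X : cover_data R).

Notation V := (vert (Gam X)).
Notation E := (edge (Gam X)).
Notation VT := (vert (GamT X)).
Notation ET := (edge (GamT X)).

Definition wtT (u : VT) : nat := (\sum_(v : V | phiV v == u) wt v)%N.

Record admissible_cover : Prop := AdmissibleCover {
  GamT_connected : connected [set: VT];
  GamT_genus : betti1 [set: VT] = 0;
  Gam_connected : connected [set: V];
  Gam_genus : arith_genus (@gen R X) [set: V] = 2;
  phi_src : forall e : E, phiV (src e) = src (phiE e);
  phi_tgt : forall e : E, phiV (tgt e) = tgt (phiE e);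
  ord12 : forall e : E, ord e = 1%N \/ ord e = 2%N;
  len_phi : forall e : E, len (phiE e) = (ord e)%:R * len e;
  ldeg_gt0 : forall v : V, (0 < ldeg v)%N;
  degree2 : forall u : VT, (\sum_(v : V | phiV v == u) ldeg v)%N = 2%N;
  harmonic_src : forall (v : V) (a : ET), src a = phiV v ->
    (\sum_(e : E | (src e == v) && (phiE e == a)) ord e)%N = ldeg v;
  harmonic_tgt : forall (v : V) (a : ET), tgt a = phiV v ->
    (\sum_(e : E | (tgt e == v) && (phiE e == a)) ord e)%N = ldeg v;
  br_six : (\sum_(u : VT) br u)%N = 6%N;
  br_ram : forall u : VT, br u = (\sum_(v : V | phiV v == u) ram v)%N;
  ram_ldeg : forall v : V, (0 < ram v)%N -> ldeg v = 2%N;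
  (* Riemann-Hurwitz for the component v, which maps to a projective line *)
  riemann_hurwitz : forall v : V,
    2 * (gen v)%:Z - 2 = - 2 * (ldeg v)%:Z + (ram v)%:Z
      + \sum_(e : E | src e == v) ((ord e)%:Z - 1)
      + \sum_(e : E | tgt e == v) ((ord e)%:Z - 1);
  wt_neq0 : exists v : V, (0 < wt v)%N;
  stability : forall u : VT, u \in orig X -> wtT u = 0%N ->
    (3 <= valence [set: ET] u + br u)%N;
  subdivision : forall u : VT, u \notin orig X ->
    [/\ valence [set: ET] u = 2%N, br u = 0%N & wtT u = 0%N]
}.

Definition Dprime (u : VT) : R :=
  (valence [set: ET] u)%:R - 2 + (br u)%:R / 2.

(* The function on Gamma_T whose pullback is the admissible function of u0. *)
Definition admissible_fun (u0 : VT) (f : VT -> R) : Prop :=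
  half_integral_slopes f /\
  (forall u : VT, Dprime u + diverg [set: ET] f u = (u == u0)%:R).

Definition normalized (f : VT -> R) : Prop :=
  (forall v : V, 0 < f (phiV v) -> wt v = 0%N) /\
  (1 <= \sum_(v : V | (0 <= f (phiV v))%R) wt v)%N.

Definition normalized_family (L : VT -> VT -> R) : Prop :=
  forall u0 : VT, u0 \in orig X -> admissible_fun u0 (L u0) /\ normalized (L u0).

Section Lambda.
Variable L : VT -> VT -> R.

Definition lamT (u : VT) : R := \big[Num.max/0]_(u0 in orig X) L u0 u.

Definition lam (v : V) : R := lamT (phiV v).

(* The model is fine enough for the maximum to be linear on every edge. *)
Definition adapted : Prop :=
  forall (a : ET) (t : R), 0 <= t <= 1 ->
    \big[Num.max/0]_(u0 in orig X) ((1 - t) * L u0 (src a) + t * L u0 (tgt a))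
    = (1 - t) * lamT (src a) + t * lamT (tgt a).

(* On an adapted model the open set {lambda > 0} consists of its vertices,
   the edges between them, and half-open edges leaving them; it retracts onto
   the subgraph induced by its vertices, which computes its connected
   components and its genus. *)
Definition Deltao : {set V} := [set v | 0 < lam v].

Definition DeltaoT : {set VT} := [set u | 0 < lamT u].

Definition Deltao_closure : {set V} :=
  Deltao :|: [set v | [exists x in Deltao, exists e : E, joins e x v]].

Definition boundaryT : {set VT} :=
  [set u | (u \notin DeltaoT) &&
           [exists x in DeltaoT, exists a : ET, joins a x u]].

(* A subcurve is a set of components, with all the nodes between them. *)
Definition genus_two_hull (S : {set V}) : Prop :=
  [/\ Deltao_closure \subset S, connected S & arith_genus (@gen R X) S = 2].

Definition is_Delta (S : {set V}) : Prop :=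
  genus_two_hull S /\ (forall S', genus_two_hull S' -> S \subset S').

End Lambda.

Section Special.
Variable S : {set V}.

Definition imV : {set VT} := [set phiV v | v in S].

Definition imE : {set ET} := [set phiE e | e in induced S].

(* Degree at u of the branch divisor of the restricted cover S -> imV: the
   points of D_B on u, and the nodes at which a ramified edge is cut off. The
   latter are needed for DprimeS to pull back to the canonical divisor of S. *)
Definition brS (u : VT) : nat :=
  (\sum_(v in S | phiV v == u)
     (ram v + \sum_(e : E | (e \notin induced S) && (src e == v)) (ord e - 1)
            + \sum_(e : E | (e \notin induced S) && (tgt e == v)) (ord e - 1)))%N.

Definition DprimeS (u : VT) : R :=
  (valence imE u)%:R - 2 + (brS u)%:R / 2.

Definition special_divisor (f : VT -> R) (u : VT) : R :=
  if u \in imV then DprimeS u + diverg imE f u else 0.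

Definition special_points (f : VT -> R) : {set VT} :=
  [set u | special_divisor f u != 0].

End Special.

End Cover.

(* Main.v *)
Require Import Defs.
From mathcomp Require Import all_boot all_order all_algebra.
From mathcomp Require Import reals.
From mathcomp Require Import zify ring lra.

Set Implicit Arguments.
Unset Strict Implicit.
Unset Printing Implicit Defensive.

Import Order.TTheory GRing.Theory Num.Theory.
Local Open Scope ring_scope.

(** Write [A] for the vertices of {lambda_T > 0} and [r] for the total ramification
    of the edges over an edge of the tree.  For connected [W] containing [A], the
    preimage of [W] is connected of genus two, and Riemann-Hurwitz turns this into
    "branch points in [W]" + "[r] of the edges leaving [W]" = 6.  Hence a branch
    of the tree hanging off [A] along an edge [a] carries exactly [r a <= 1] branch
    points, and summing the defining equation of an admissible function over
    this branch shows that its slope on [a] towards [A] is positive.  So every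
    admissible function attains its maximum off [A] on the boundary of [A] only;
    by normalization and uniqueness of [v], they all vanish at [v].  The maximum
    principle applied to differences of admissible functions gives
    lambda_T = max (0, lambda_v), and this agrees with lambda_v on the closure of
    [A] because the model is adapted.  The closure of [A] has the genus two
    preimage Delta, on which the divisor is read off from the slopes of
    lambda_v. *)

(** * Cuts, connectedness and divisors on a metric graph *)

Section Cuts.
Variables (R : realType) (G : mgraph R).
Implicit Types (K P S U W : {set vert G}) (e : edge G) (f : vert G -> R).

Definition cuts P e : bool := (src e \in P) (+) (tgt e \in P).

(** Connectedness as absence of separations, a form that transports well along the cover. The empty
    set satisfies it, whereas [connected] excludes it. *)
Definition cut_connected W : Prop :=
  forall P, P \subset W -> P != set0 -> P != W ->
  exists2 e, e \in induced W & cuts P e.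

Lemma cutsC P e : cuts (~: P) e = cuts P e.
Proof. by rewrite /cuts !inE; case: (_ \in _); case: (_ \in _). Qed.

Lemma cutsI W P e : e \in induced W -> cuts (P :&: W) e = cuts P e.
Proof. by rewrite /cuts !inE => /andP[-> ->]; rewrite !andbT. Qed.

Lemma joins_sym e x y : joins e x y = joins e y x.
Proof. by rewrite /joins orbC. Qed.

Lemma joins_cuts P e x y : joins e x y -> x \in P -> y \notin P -> cuts P e.
Proof.
by rewrite /cuts => /orP[] /andP[/eqP -> /eqP ->] -> /negbTE ->.
Qed.

Lemma joins_induced W e x y :
  joins e x y -> x \in W -> y \in W -> e \in induced W.
Proof. by rewrite inE => /orP[] /andP[/eqP -> /eqP ->] -> ->. Qed.

Lemma cutsP P e : cuts P e -> exists x y, [/\ joins e x y, x \in P & y \notin P].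
Proof.
rewrite /cuts /joins; case: (boolP (src e \in P)) => sP /= tP.
  by exists (src e), (tgt e); rewrite !eqxx.
by exists (tgt e), (src e); rewrite !eqxx orbT.
Qed.

Lemma joins_cut_inj K e x y x' y' : joins e x y -> joins e x' y' ->
  x \in K -> x' \in K -> y \notin K -> y' \notin K -> x = x' /\ y = y'.
Proof.
move=> /orP[] /andP[/eqP <- /eqP <-] /orP[] /andP[/eqP <- /eqP <-] //.
  by move=> sK _ _; rewrite sK.
by move=> tK _ _; rewrite tK.
Qed.

(** A set [P] either separates [S] itself, or is disjoint from [S], or contains [S]. In the last two
    cases an edge from [S] to a vertex of [P], respectively of [W] outside [P], is cut. *)
Lemma cut_connected_ext S W : cut_connected S -> S != set0 -> S \subset W ->
  (forall z, z \in W -> z \notin S -> exists x e, x \in S /\ joins e x z) ->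
  cut_connected W.
Proof.
move=> cS S0 SW adjW P PW P0 PneqW.
have toS (Z : {set vert G}) z x e : z \in W -> x \in S -> joins e x z ->
    (x \in Z) != (z \in Z) -> e \in induced W /\ cuts Z e.
  move=> zW xS xez xzZ; split.
    exact: joins_induced xez (subsetP SW _ xS) zW.
  move: xzZ; case: (boolP (x \in Z)) => xZ; case: (boolP (z \in Z)) => zZ // _.
    exact: joins_cuts xez xZ zZ.
  by rewrite joins_sym in xez; exact: joins_cuts xez zZ xZ.
case: (eqVneq (P :&: S) set0) => [PS0|PSn0].
  have /set0Pn[z zP] := P0.
  have zW := subsetP PW z zP.
  have notPS x : x \in S -> x \notin P.
    by move=> xS; apply/negP => xP; have : x \in P :&: S by [rewrite inE xP];
      rewrite PS0 inE.
  have zS : z \notin S by apply/negP => /notPS; rewrite zP.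
  have [x [e [xS xez]]] := adjW z zW zS.
  by have [] := toS P z x e zW xS xez;
    [rewrite zP (negbTE (notPS _ xS))|exists e].
case: (eqVneq (P :&: S) S) => [PSS|PSnS].
  have SP : S \subset P by apply/setIidPr.
  have /subsetPn[z zW zP] : ~~ (W \subset P).
    by apply: contra PneqW => WP; rewrite eqEsubset PW.
  have zS : z \notin S by apply: contra zP; apply: (subsetP SP).
  have [x [e [xS xez]]] := adjW z zW zS.
  by have [] := toS P z x e zW xS xez;
    [rewrite (negbTE zP) (subsetP SP _ xS)|exists e].
have [e eS ce] := cS _ (subsetIr P S) PSn0 PSnS.
exists e; last by rewrite -(cutsI _ eS).
by move: eS; rewrite !inE => /andP[/(subsetP SW) -> /(subsetP SW) ->].
Qed.

Lemma cut_connected_setU1 K e x z :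
  cut_connected K -> x \in K -> joins e x z -> cut_connected (z |: K).
Proof.
move=> cK xK xez; apply: (cut_connected_ext cK).
- by apply/set0Pn; exists x.
- exact: subsetUr.
by move=> t; rewrite !inE => /orP[/eqP->|->//] _; exists x, e.
Qed.

(** Some edge inside [W] cuts [S]; adding its outer end gains one vertex and at least one edge. So
    edges minus vertices never decreases while [S] grows to [W]. *)
Lemma card_induced_growth S W : cut_connected W -> S \subset W -> S != set0 ->
  (#|induced S| + #|W| <= #|induced W| + #|S|)%N.
Proof.
move=> cW; have [n] := ubnP (#|W| - #|S|)%N.
elim: n S => // n IH S ltn SW S0.
case: (eqVneq S W) => [->//|SneqW].
have [e eW ce] := cW S SW S0 SneqW.
have [x [y [xey xS yS]]] := cutsP ce.
have yW : y \in W.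
  by move: eW; rewrite inE; case/orP: xey => /andP[/eqP-> /eqP->] /andP[].
have ySW : y |: S \subset W by rewrite subUset sub1set yW.
have card_yS := cardsU1 y S; rewrite yS /= in card_yS.
have ltSW : (#|y |: S| <= #|W|)%N := subset_leq_card ySW.
have := IH (y |: S); rewrite card_yS => /(_ _ ySW).
have yS0 : y |: S != set0 by apply/set0Pn; exists y; rewrite !inE eqxx.
move=> /(_ _ yS0) IHS.
have {}IHS : (#|induced (y |: S)| + #|W| <= #|induced W| + #|S|.+1)%N.
  by rewrite -add1n; apply: IHS; move: ltSW ltn; rewrite card_yS; clear; lia.
have eS : e \notin induced S.
  by apply: contraL ce; rewrite /cuts inE => /andP[-> ->].
have : (#|e |: induced S| <= #|induced (y |: S)|)%N.
  apply/subset_leq_card; rewrite subUset sub1set; apply/andP; split.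
    by apply: (joins_induced xey); rewrite !inE ?eqxx ?xS ?orbT.
  by apply/subsetP => a; rewrite !inE => /andP[-> ->]; rewrite !orbT.
rewrite cardsU1 eS /=; move: IHS; clear; lia.
Qed.

Lemma adj_connect_sym S : connect_sym (adj S).
Proof.
apply: sym_connect_sym => x y; rewrite /adj /= andbCA; congr (_ && (_ && _)).
by apply: eq_existsb => e; rewrite joins_sym.
Qed.

Lemma adj_closed S : closed (adj S) (mem S).
Proof. by move=> x y /and3P[xS yS _]; rewrite xS yS. Qed.

Lemma connectedP S : connected S <-> S != set0 /\ cut_connected S.
Proof.
rewrite /connected /ncomp; split=> [c1|[S0 cS]]; last first.
  have /set0Pn[x xS] := S0.
  rewrite -(n_comp_connect (adj_connect_sym S) x); apply: eq_n_comp_r => z.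
  rewrite !inE; apply/idP/idP => [|xz]; last first.
    by rewrite -(closed_connect (@adj_closed S) xz).
  (* The component of [x]: an edge cutting it would extend a path from [x] beyond it. *)
  pose P := [set z in S | connect (adj S) x z].
  have PS : P \subset S by apply/subsetP => t; rewrite inE => /andP[].
  have xP : x \in P by rewrite inE xS connect0.
  suff PS' : P = S by rewrite -{1}PS' inE => /andP[].
  apply/eqP/negPn/negP => PneqS.
  have P0 : P != set0 by apply/set0Pn; exists x.
  have [e eS /cutsP[y [t [yet yP]]]] := cS P PS P0 PneqS.
  have tS : t \in S.
    by move: eS; rewrite inE; case/orP: yet => /andP[/eqP-> /eqP->] /andP[].
  move: yP; rewrite inE => /andP[yS xy]; rewrite inE tS /= => /negP; apply.
  apply: connect_trans xy _; apply: connect1.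
  by rewrite /adj /= yS tS; apply/existsP; exists e.
have [x /andP[rx xS]] : exists x, (x \in roots (adj S)) && (x \in S).
  have : (0 < n_comp (adj S) (mem S))%N by rewrite c1.
  by rewrite /n_comp_mem => /card_gt0P[x]; rewrite !inE => h; exists x.
have conn_x y : y \in S -> connect (adj S) x y.
  move=> yS; rewrite adj_connect_sym.
  have ry : fingraph.root (adj S) y \in S by rewrite -(closed_connect (@adj_closed S) (connect_root _ _)).
  have /eqP/card1P[t ht] := c1.
  have /eqP-> : x \in pred1 t by rewrite -ht; apply/andP.
  have /eqP<- : fingraph.root (adj S) y \in pred1 t.
    by rewrite -ht; apply/andP; split=> //;
      apply: (roots_root (adj_connect_sym S)).
  exact: connect_root.
split; first by apply/set0Pn; exists x.
move=> P PS /set0Pn[p pP] PneqS.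
suff /existsP[e /andP[eS ce]] : [exists e, (e \in induced S) && cuts P e].
  by exists e.
apply: contraT => /existsPn none.
(* A set cut by no edge is closed under adjacency, so it contains everything connected to [p]. *)
have clP : closed (adj S) (mem P).
  move=> y t /and3P[yS tS /existsP[e yet]].
  apply/idP/idP => [yP|tP]; apply/negPn/negP => nP; have := none e.
    by rewrite (joins_induced yet) // (joins_cuts yet).
  by rewrite joins_sym in yet; rewrite (joins_induced yet) // (joins_cuts yet).
case/negP: PneqS; rewrite eqEsubset PS; apply/subsetP => y yS.
have xp : connect (adj S) x p by apply: conn_x; apply: (subsetP PS).
by rewrite -[y \in P](closed_connect clP (conn_x y yS)) (closed_connect clP xp).
Qed.

Lemma valenceE (A : {set edge G}) v :
  valence A v = (\sum_(e in A) ((src e == v) + (tgt e == v)))%N.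
Proof.
rewrite big_split /= /valence -!sum1_card.
by congr addn; rewrite [RHS]big_mkcond [LHS]big_mkcond; apply: eq_bigr => e _;
  rewrite !inE; case: (e \in A) => //=; case: (_ == v).
Qed.

(** Signed slopes edge by edge, so that sums over vertices and edges can be exchanged. A loop
    contributes zero in both forms. *)
Lemma divergE (A : {set edge G}) f v :
  diverg A f v = \sum_(e in A)
    ((src e == v)%:R - (tgt e == v)%:R) * ((f (tgt e) - f (src e)) / len e).
Proof.
rewrite /diverg [X in X + _]big_mkcondr [X in _ + X]big_mkcondr -big_split /=.
apply: eq_bigr => e _.
case: (eqVneq (src e) v) => [<-|_]; case: (eqVneq (tgt e) _) => [->|_] /=.
- by rewrite !subrr !mul0r addr0.
- by rewrite addr0 subr0 mul1r.
- by rewrite add0r sub0r mulN1r -mulNr opprB.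
- by rewrite subrr mul0r addr0.
Qed.

Lemma sum_eq_mem (I : finType) (S : {set I}) (x : I) :
  (\sum_(u in S) (x == u) = (x \in S))%N.
Proof.
case: (boolP (x \in S)) => xS.
  rewrite (bigD1 x) //= eqxx big1 ?addn0 // => u /andP[_].
  by rewrite eq_sym => /negbTE->.
by rewrite big1 // => u uS; case: eqP => // xu; rewrite xu uS in xS.
Qed.

Lemma sum_valence S :
  (\sum_(v in S) valence [set: edge G] v =
   2 * #|induced S| + \sum_(e | cuts S e) 1)%N.
Proof.
under eq_bigr do rewrite valenceE.
rewrite exchange_big /= -sum1_card big_distrr /= [X in (X + _)%N]big_mkcond.
rewrite [X in (_ + X)%N]big_mkcond -big_split /=.
rewrite (eq_bigl xpredT) => [|e]; last by rewrite inE.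
apply: eq_bigr => e _; rewrite big_split /= !sum_eq_mem /cuts !inE.
by case: (_ \in _); case: (_ \in _).
Qed.

(** Discrete divergence theorem: the two ends of an edge inside [S] contribute opposite slopes, so
    only the cut edges survive. *)
Lemma sum_diverg S f :
  \sum_(v in S) diverg [set: edge G] f v =
  \sum_(e | cuts S e)
    ((src e \in S)%:R - (tgt e \in S)%:R) * ((f (tgt e) - f (src e)) / len e).
Proof.
under eq_bigr do rewrite divergE.
rewrite exchange_big /= [RHS]big_mkcond.
rewrite (eq_bigl xpredT) => [|e]; last by rewrite inE.
apply: eq_bigr => e _; rewrite -big_distrl sumrB -!natr_sum !sum_eq_mem /cuts.
by do 2![case: (_ \in _)]; rewrite /= ?subrr ?mul0r.
Qed.

Lemma divergB f g v : diverg [set: edge G] (fun x => f x - g x) v =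
  diverg [set: edge G] f v - diverg [set: edge G] g v.
Proof.
rewrite !divergE -sumrB; apply: eq_bigr => e _.
by rewrite -mulrBr -mulrBl; congr (_ * (_ / _)); ring.
Qed.

(* On the set where [f] is maximal, all the boundary slopes are negative. *)
Lemma maximum_principle f v : cut_connected [set: vert G] ->
  (forall u, u != v -> 0 <= diverg [set: edge G] f u) ->
  forall u, f u <= f v.
Proof.
move=> cG div_ge0 u.
pose m := [arg max_(x > u) f x]%O.
have max_m x : f x <= f m by rewrite /m;
  case: Order.TotalTheory.arg_maxP => // i _; apply.
suff <- : f m = f v by [].
pose M := [set x | f x == f m].
case: (boolP (v \in M)) => [|vM]; first by rewrite inE => /eqP.
have M0 : M != set0 by apply/set0Pn; exists m; rewrite inE.
have MT : M != [set: vert G] by apply: contraNneq vM => ->; rewrite inE.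
have [e _ ce] := cG M (subsetT _) M0 MT.
have : 0 <= \sum_(x in M) diverg [set: edge G] f x.
  by apply: sumr_ge0 => x xM; apply: div_ge0; apply: contraNneq vM => <-.
have neg a : cuts M a -> ((src a \in M)%:R - (tgt a \in M)%:R) *
    ((f (tgt a) - f (src a)) / len a) < 0.
  have l0 : 0 < (len a)^-1 by rewrite invr_gt0 len_gt0.
  have := max_m (tgt a); have := max_m (src a).
  rewrite /cuts !inE !le_eqVlt.
  case: eqP => [->|_] /=; case: eqP => [->|_] //= h1 h2 _.
    by rewrite subr0 mul1r nmulr_rlt0 // subr_lt0.
  by rewrite sub0r mulN1r oppr_lt0 mulr_gt0 // subr_gt0.
rewrite sum_diverg (bigD1 e) //= leNgt => /negP[].
rewrite -[ltRHS]addr0 ltr_leD ?neg //.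
by apply: sumr_le0 => a /andP[ca _]; apply/ltW/neg.
Qed.

End Cuts.

(** * Edge counts and branches in a tree *)

Section Trees.
Variables (R : realType) (G : mgraph R).
Hypothesis G_conn : cut_connected [set: vert G].
Hypothesis G_euler : (#|edge G| + 1 = #|vert G|)%N.
Implicit Types (K Q S W : {set vert G}) (e : edge G).

(** Growing [S] to the whole graph cannot lower edges minus vertices, which is -1 for the tree. *)
Lemma card_induced_forest S : S != set0 -> (#|induced S| + 1 <= #|S|)%N.
Proof.
move=> S0; have := card_induced_growth G_conn (subsetT S) S0.
have := subset_leq_card (subsetT (induced [set: vert G])); rewrite !cardsT;
  move: G_euler; clear; lia.
Qed.

(** Growing from a single vertex to [W] gives the inequality opposite to [card_induced_forest]. *)
Lemma card_induced_subtree W :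
  cut_connected W -> W != set0 -> (#|induced W| + 1 = #|W|)%N.
Proof.
move=> cW W0; have := card_induced_forest W0; have /set0Pn[x xW] := W0.
have := @card_induced_growth _ _ [set x] W cW; rewrite sub1set cards1.
have x0 : [set x] != set0 by apply/set0Pn; exists x; rewrite inE.
move=> /(_ xW x0); clear; lia.
Qed.

Lemma card_edge_cut S :
  (#|edge G| = #|induced S| + #|induced (~: S)| + \sum_(e | cuts S e) 1)%N.
Proof.
rewrite -!sum1_card [RHS]addnC addnA.
rewrite [X in (X + _ + _)%N]big_mkcond [X in (_ + X + _)%N]big_mkcond.
rewrite [X in (_ + _ + X)%N]big_mkcond -!big_split /=.
rewrite (eq_bigl xpredT) //; apply: eq_bigr => e _; rewrite /cuts !inE.
by case: (_ \in _); case: (_ \in _).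
Qed.

(* [K] is the connected component of [A] in the complement of [y]. *)
Lemma tree_side A y : cut_connected A -> A != set0 -> y \notin A ->
  exists K e x, [/\ [/\ cut_connected K, A \subset K & y \notin K],
    x \in K, joins e x y & forall e', cuts K e' = (e' == e)].
Proof.
move=> cA A0 yA.
(* Boolean form of the required properties, so that a maximal such set exists. *)
pose good (K : {set vert G}) := [&& A \subset K, y \notin K &
  [forall P : {set vert G}, [&& P \subset K, P != set0 & P != K] ==>
    [exists e, (e \in induced K) && cuts P e]]].
have goodP K : reflect [/\ A \subset K, y \notin K & cut_connected K] (good K).
  apply: (iffP and3P) => -[AK yK cK]; split=> //.
    move=> P PK P0 PnK; move/forallP: cK => /(_ P); rewrite PK P0 PnK /=.
    by case/existsP=> e /andP[eK ce]; exists e.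
  apply/forallP => P; apply/implyP => /and3P[PK P0 PnK].
  by have [e eK ce] := cK P PK P0 PnK; apply/existsP; exists e; rewrite eK.
have goodA : good A by apply/goodP.
have [K /maxsetP[/goodP[AK yK cK] maxK] _] := maxset_exists goodA.
have K0 : K != set0 by apply: contraNneq A0 => K0; rewrite -subset0 -K0.
(* By maximality, an edge leaving [K] can only lead to [y]: any other outer end could be added to
   [K]. *)
have to_y e x z : joins e x z -> x \in K -> z \notin K -> z = y.
  move=> xez xK zK; apply/eqP; apply: contraNT zK => zy.
  rewrite -(maxK (z |: K)) ?subsetUr ?setU11 //; apply/goodP; split.
  - exact: subset_trans AK (subsetUr _ _).
  - by rewrite !inE eq_sym negb_or zy.
  - exact: cut_connected_setU1 cK xK xez.
have KT : K != [set: vert G] by apply: contraNneq yK => ->; rewrite inE.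
have [e _ ce] := G_conn (subsetT K) K0 KT.
have [x [z [xez xK zK]]] := cutsP ce.
have zy := to_y _ _ _ xez xK zK; subst z.
exists K, e, x; split=> // e'; apply/idP/eqP => [ce'|->//].
(* A second edge from [K] to [y] would give [y |: K] as many edges as vertices, which a forest
   forbids. *)
apply/eqP/negPn/negP => ne.
have [x' [z' [xez' xK' zK']]] := cutsP ce'.
have zy := to_y _ _ _ xez' xK' zK'; subst z'.
have cutNind a : cuts K a -> a \notin induced K.
  by apply: contraL; rewrite /cuts inE => /andP[-> ->].
have: (#|e |: (e' |: induced K)| <= #|induced (y |: K)|)%N.
  apply/subset_leq_card; rewrite !subUset !sub1set; apply/and3P; split.
  - by apply: (joins_induced xez); rewrite !inE ?eqxx ?xK ?orbT.
  - by apply: (joins_induced xez'); rewrite !inE ?eqxx ?xK' ?orbT.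
  - by apply/subsetP => a; rewrite !inE => /andP[-> ->]; rewrite !orbT.
have yK0 : y |: K != set0 by apply/set0Pn; exists y; rewrite setU11.
have := card_induced_forest yK0; have := card_induced_subtree cK K0.
rewrite !cardsU1 yK (cutNind _ ce') in_setU1 (negbTE (cutNind _ ce)).
by rewrite eq_sym (negbTE ne) /=; clear; lia.
Qed.

(** A loop would be a subgraph with one vertex and one edge. *)
Lemma no_loop e : src e != tgt e.
Proof.
apply/negP => /eqP loop.
have e0 : [set src e] != set0 by apply/set0Pn; exists (src e); rewrite inE.
have := card_induced_forest e0; rewrite cards1 addn1 ltnNge.
move/negP; apply.
by apply/card_gt0P; exists e; rewrite !inE -loop eqxx.
Qed.

(** Deleting [e] leaves two fewer edges than vertices; the subtree [K] accounts for one of the two,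
    its complement for the other. *)
Lemma card_induced_side K e : cut_connected K -> K != set0 ->
  (forall e', cuts K e' = (e' == e)) -> (#|induced (~: K)| + 1 = #|~: K|)%N.
Proof.
move=> cK K0 cutK; have := card_edge_cut K;
  rewrite (eq_bigl _ _ cutK) big_pred1_eq.
have := card_induced_subtree cK K0; have := cardsC K; move: G_euler; clear; lia.
Qed.

End Trees.

(** * Fibres of the cover and Riemann-Hurwitz over sets of vertices of the tree *)

Section Covers.
Variables (R : realType) (X : cover_data R).
Hypothesis hX : admissible_cover X.

Notation V := (vert (Gam X)).
Notation E := (edge (Gam X)).
Notation VT := (vert (GamT X)).
Notation ET := (edge (GamT X)).
Implicit Types (U W N : {set VT}) (a : ET) (u : VT).

(** Over [a] lies one edge of order two or two edges of order one, so the value is 1 or 0. *)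
Definition edge_ram a : nat := (\sum_(e : E | phiE e == a) (ord e - 1))%N.

Lemma ord_gt0 (e : E) : (0 < ord e)%N.
Proof. by case: (ord12 hX e) => ->. Qed.

(** Grouped by source, the orders over [a] add up to the local degrees over [src a], by
    harmonicity. *)
Lemma sum_ord_fiber a : (\sum_(e : E | phiE e == a) ord e)%N = 2%N.
Proof.
rewrite -(degree2 hX (src a)).
rewrite (partition_big (@src _ _) (fun v => phiV v == src a)) /=; last first.
  by move=> e /eqP<-; rewrite (phi_src hX).
apply: eq_bigr => v /eqP/esym av; rewrite -(harmonic_src hX av).
by apply: eq_bigl => e; rewrite andbC.
Qed.

Lemma edge_ram_card a : (edge_ram a + #|[set e : E | phiE e == a]| = 2)%N.
Proof.
rewrite -(sum_ord_fiber a) /edge_ram -sum1_card [X in (_ + X)%N](eq_bigl (fun e => phiE e == a)).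
  by rewrite -big_split /=; apply: eq_bigr => e _; rewrite subnK ?ord_gt0.
by move=> e; rewrite inE.
Qed.

Lemma phiE_surj a : exists e : E, phiE e = a.
Proof.
suff /set0Pn[e] : [set e : E | phiE e == a] != set0 by rewrite inE => /eqP;
  exists e.
apply/negP => /eqP fib0; have := sum_ord_fiber a; rewrite big_pred0 // => e.
by apply/negP => ea; have := in_set0 e; rewrite -fib0 inE ea.
Qed.

Lemma edge_ram_le1 a : (edge_ram a <= 1)%N.
Proof.
have := edge_ram_card a; have [e ea] := phiE_surj a.
suff : (0 < #|[set e : E | phiE e == a]|)%N by clear; lia.
by apply/card_gt0P; exists e; rewrite inE ea.
Qed.

Lemma phiV_surj u : exists v : V, phiV v = u.
Proof.
suff /set0Pn[v] : [set v : V | phiV v == u] != set0 by rewrite inE => /eqP;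
  exists v.
apply/negP => /eqP fib0; have := degree2 hX u; rewrite big_pred0 // => v.
by apply/negP => vu; have := in_set0 v; rewrite -fib0 inE vu.
Qed.

Lemma phi_joins (e : E) x y : joins e x y -> joins (phiE e) (phiV x) (phiV y).
Proof.
rewrite /joins -(phi_src hX) -(phi_tgt hX).
by case/orP=> /andP[/eqP-> /eqP->]; rewrite !eqxx ?orbT.
Qed.

Lemma phi_cuts U (e : E) : cuts (@phiV R X @^-1: U) e = cuts U (phiE e).
Proof. by rewrite /cuts !inE (phi_src hX) (phi_tgt hX). Qed.

Lemma phi_induced U (e : E) :
  (e \in induced (@phiV R X @^-1: U)) = (phiE e \in induced U).
Proof. by rewrite !inE (phi_src hX) (phi_tgt hX). Qed.

(** Local degrees are positive, so by harmonicity every edge at [phiV v] has a lift at [v]. *)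
Lemma lift_joins a u (v : V) : joins a u (phiV v) ->
  exists e x, [/\ joins e x v, phiE e = a & phiV x = u].
Proof.
case/orP=> /andP[/eqP au /eqP av].
  have : [exists e : E, (tgt e == v) && (phiE e == a)].
    apply: contraT => /existsPn none; have := ldeg_gt0 hX v.
    by rewrite -(harmonic_tgt hX av) big_pred0 // => e; apply/negbTE/none.
  case/existsP=> e /andP[/eqP tv /eqP ea]; exists e, (src e).
  by rewrite /joins tv !eqxx (phi_src hX) ea.
have : [exists e : E, (src e == v) && (phiE e == a)].
  apply: contraT => /existsPn none; have := ldeg_gt0 hX v.
  by rewrite -(harmonic_src hX au) big_pred0 // => e; apply/negbTE/none.
case/existsP=> e /andP[/eqP sv /eqP ea]; exists e, (tgt e).
by rewrite /joins sv !eqxx orbT (phi_tgt hX) ea.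
Qed.

Lemma sum_preim U (F : V -> nat) :
  (\sum_(v in @phiV R X @^-1: U) F v = \sum_(u in U) \sum_(v | phiV v == u) F v)%N.
Proof.
rewrite (partition_big (@phiV R X) (mem U)) => [|v]; last by rewrite inE.
apply: eq_bigr => u uU; apply: eq_bigl => v; rewrite inE.
by case: eqP => [->|]; rewrite ?andbF // andbT.
Qed.

Lemma sum_edge_fiber (P : pred ET) (F : E -> nat) :
  (\sum_(e | P (phiE e)) F e = \sum_(a | P a) \sum_(e | phiE e == a) F e)%N.
Proof.
rewrite (partition_big (@phiE R X) P) //.
apply: eq_bigr => a Pa; apply: eq_bigl => e.
by case: eqP => [->|]; rewrite ?andbF // andbT.
Qed.

Lemma sum_src_preim U (F : E -> nat) :
  (\sum_(v in @phiV R X @^-1: U) \sum_(e | src e == v) F e =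
   \sum_(a | src a \in U) \sum_(e | phiE e == a) F e)%N.
Proof.
rewrite -(sum_edge_fiber (fun a => src a \in U)).
rewrite [RHS](partition_big (@src _ _) (mem (@phiV R X @^-1: U))) => [|e];
  last first.
  by move=> eU; rewrite /= inE (phi_src hX).
apply: eq_bigr => v vU; apply: eq_bigl => e.
case: eqP => [ev|]; rewrite ?andbF // andbT -(phi_src hX) ev.
by move: vU; rewrite inE => ->.
Qed.

Lemma sum_tgt_preim U (F : E -> nat) :
  (\sum_(v in @phiV R X @^-1: U) \sum_(e | tgt e == v) F e =
   \sum_(a | tgt a \in U) \sum_(e | phiE e == a) F e)%N.
Proof.
rewrite -(sum_edge_fiber (fun a => tgt a \in U)).
rewrite [RHS](partition_big (@tgt _ _) (mem (@phiV R X @^-1: U))) => [|e];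
  last first.
  by move=> eU; rewrite /= inE (phi_tgt hX).
apply: eq_bigr => v vU; apply: eq_bigl => e.
case: eqP => [ev|]; rewrite ?andbF // andbT -(phi_tgt hX) ev.
by move: vU; rewrite inE => ->.
Qed.

Lemma riemann_hurwitz_nat (v : V) :
  (2 * gen v + 2 * ldeg v = ram v + \sum_(e | src e == v) (ord e - 1)
     + \sum_(e | tgt e == v) (ord e - 1) + 2)%N.
Proof.
have cast (P : pred E) :
    \sum_(e | P e) ((ord e)%:Z - 1) = (\sum_(e | P e) (ord e - 1))%N%:Z.
  rewrite (big_morph Posz PoszD (erefl _)); apply: eq_bigr => e _.
  by rewrite -subzn ?ord_gt0.
have := riemann_hurwitz hX v; rewrite !cast; clear; lia.
Qed.

Lemma card_induced_preim U : (#|induced (@phiV R X @^-1: U)| =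
  \sum_(a in induced U) #|[set e : E | phiE e == a]|)%N.
Proof.
rewrite -sum1_card (eq_bigl (fun e => phiE e \in induced U)) => [|e];
  last first.
  exact: phi_induced.
rewrite (sum_edge_fiber (fun a => a \in induced U)); apply: eq_bigr => a _.
by rewrite -sum1_card; apply: eq_bigl => e; rewrite inE.
Qed.

(** The sum of the local Riemann-Hurwitz formulas over all vertices above [U]. *)
Lemma riemann_hurwitz_preim U :
  (2 * \sum_(v in @phiV R X @^-1: U) gen v + 4 * #|U|
     + 2 * #|induced (@phiV R X @^-1: U)|
   = \sum_(u in U) br u + 4 * #|induced U| + \sum_(a | cuts U a) edge_ram a
     + 2 * #|@phiV R X @^-1: U|)%N.
Proof.
have rh : (\sum_(v in @phiV R X @^-1: U) (2 * gen v + 2 * ldeg v) =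
  \sum_(v in @phiV R X @^-1: U) (ram v + \sum_(e | src e == v) (ord e - 1)
     + \sum_(e | tgt e == v) (ord e - 1) + 2))%N.
  by apply: eq_bigr => v _; rewrite riemann_hurwitz_nat.
move: rh; rewrite !big_split /= !big1_eq !addn0 sum_src_preim sum_tgt_preim.
have -> : (\sum_(v in @phiV R X @^-1: U) ldeg v = #|U| * 2)%N.
  by rewrite sum_preim -sum_nat_const; apply: eq_bigr => u _;
    rewrite (degree2 hX).
have -> : (\sum_(v in @phiV R X @^-1: U) ram v = \sum_(u in U) br u)%N.
  by rewrite sum_preim; apply: eq_bigr => u _; rewrite (br_ram hX).
(* An edge inside [U] is met from both ends and its ramification is 2 minus the size of its fibre; a
   cut edge is met once. *)
have edges : (\sum_(a | src a \in U) edge_ram a + \sum_(a | tgt a \in U) edge_ram a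
    + 2 * #|induced (@phiV R X @^-1: U)| =
    4 * #|induced U| + \sum_(a | cuts U a) edge_ram a)%N.
  have cond (P : pred ET) F : (\sum_(a | P a) F a = \sum_a (P a : nat) * F a)%N.
    rewrite big_mkcond; apply: eq_bigr => a _.
    by case: (P a); rewrite ?mul1n ?mul0n.
  have -> : #|induced U| = (\sum_a (a \in induced U))%N.
    by rewrite -sum1_card (cond (fun a => a \in induced U));
      apply: eq_bigr => a _; rewrite muln1.
  rewrite card_induced_preim (cond (fun a => src a \in U)) (cond (fun a => tgt a \in U)).
  rewrite (cond (cuts U)) (cond (fun a => a \in induced U)) !big_distrr -!big_split /=.
  apply: eq_bigr => a _; have := edge_ram_card a; rewrite /cuts [a \in _]inE.
  by do 2![case: (_ \in U)] => /=; clear; lia.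
move: edges; rewrite /edge_ram !sum_nat_const; clear; lia.
Qed.

Lemma GamT_cut_connected : cut_connected [set: VT].
Proof. by have /connectedP[] := GamT_connected hX. Qed.

Lemma induced_setT (G : mgraph R) : induced [set: vert G] = [set: edge G].
Proof. by apply/setP => e; rewrite !inE. Qed.

Lemma GamT_euler : (#|ET| + 1 = #|VT|)%N.
Proof.
have := GamT_genus hX; rewrite /betti1 (GamT_connected hX) induced_setT !cardsT.
clear; lia.
Qed.

Lemma connected_genus2 (S : {set V}) : connected S ->
  arith_genus (@gen R X) S = 2 <-> (#|induced S| + \sum_(v in S) gen v = #|S| + 1)%N.
Proof. by rewrite /arith_genus /betti1 => ->; clear; lia. Qed.

(** * Subtrees containing a set with connected preimage of genus two *)

Section GenusTwo.
Variable A : {set VT}.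
Hypothesis A_conn : connected (@phiV R X @^-1: A).
Hypothesis A_genus : arith_genus (@gen R X) (@phiV R X @^-1: A) = 2.

Lemma genus2_neq0 : A != set0.
Proof.
have /connectedP[/set0Pn[v]] := A_conn; rewrite inE => vA _.
by apply/set0Pn; exists (phiV v).
Qed.

(** A separation of [A] would pull back to one of its connected preimage. *)
Lemma genus2_cut_connected : cut_connected A.
Proof.
have /connectedP[_ cA] := A_conn.
move=> P PA /set0Pn[p pP] PneqA.
have /subsetPn[q qA qP] : ~~ (A \subset P).
  by apply: contra PneqA => AP; rewrite eqEsubset PA.
have [p' p'P] := phiV_surj p; have [q' q'Q] := phiV_surj q.
case: (cA (@phiV R X @^-1: P)).
- exact: preimsetS.
- by apply/set0Pn; exists p'; rewrite inE p'P.
- apply: contraNneq qP => eqP_.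
  by have : q' \in @phiV R X @^-1: P; [rewrite eqP_ inE q'Q | rewrite inE q'Q].
by move=> e; rewrite phi_induced phi_cuts; exists (phiE e).
Qed.

Section Larger.
Variable W : {set VT}.
Hypotheses (W_conn : cut_connected W) (AW : A \subset W).

Lemma preim_connected : connected (@phiV R X @^-1: W).
Proof.
have /connectedP[A0 cA] := A_conn.
have AWp := preimsetS (@phiV R X) AW.
apply/connectedP; split.
  by apply: contraNneq A0 => W0; rewrite -subset0 -W0.
(* It suffices to treat [P] containing the preimage of [A]: a [P] meeting it properly is cut inside
   it, and a disjoint [P] is replaced by its complement. *)
suff H (P : {set V}) : P \subset @phiV R X @^-1: W ->
    @phiV R X @^-1: A \subset P ->
    P != @phiV R X @^-1: W -> exists2 e, e \in induced (@phiV R X @^-1: W) & cuts P e.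
  move=> P PW P0 PneqW.
  case: (eqVneq (P :&: @phiV R X @^-1: A) (@phiV R X @^-1: A)) => [PA|PnA].
    by apply: H => //; apply/setIidPr.
  case: (eqVneq (P :&: @phiV R X @^-1: A) set0) => [PA|PA0]; last first.
    have [e eA ce] := cA _ (subsetIr P _) PA0 PnA.
    exists e; last by rewrite -(cutsI _ eA).
    by move: eA; rewrite !inE => /andP[/(subsetP AW) -> /(subsetP AW) ->].
  have [|||e eW ce] := H (@phiV R X @^-1: W :\: P).
  - exact: subsetDl.
  - by rewrite subsetD AWp disjoint_sym -setI_eq0 PA eqxx.
  - have /set0Pn[p pP] := P0; apply/negP => /eqP eqW.
    by have := subsetP PW p pP; rewrite -eqW inE pP.
  exists e => //; move: eW ce; rewrite /cuts !inE => /andP[-> ->].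
  by rewrite !andbT; do 2![case: (_ \in P)].
move=> PW AP PneqW.
(* The vertices whose whole fibre lies in [P]. An edge leaving [Z] lifts to one ending at a vertex
   outside [P]; its other end lies over [Z], hence in [P]. *)
pose Z := [set u in W | [forall v : V, (phiV v == u) ==> (v \in P)]].
have ZW : Z \subset W by apply/subsetP => u; rewrite inE => /andP[].
have AZ : A \subset Z.
  apply/subsetP => u uA; rewrite inE (subsetP AW) //=.
  apply/forallP => v; apply/implyP => /eqP vu; apply: (subsetP AP).
  by rewrite inE vu.
have Z0 : Z != set0.
  by apply: contraNneq genus2_neq0 => Z0; rewrite -subset0 -Z0.
have ZneqW : Z != W.
  apply: contraNneq PneqW => ZW'; rewrite eqEsubset PW; apply/subsetP => v.
  rewrite inE -ZW' inE => /andP[_ /forallP/(_ v)/implyP]; exact.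
have [a aW /cutsP[z [u [zau zZ uZ]]]] := W_conn ZW Z0 ZneqW.
have uW : u \in W.
  by move: aW; rewrite inE; case/orP: zau => /andP[/eqP-> /eqP->] /andP[].
move: uZ; rewrite inE uW /= => /forallPn[v];
  rewrite negb_imply => /andP[/eqP vu vP].
rewrite -vu in zau; have [e [x [xev ea xz]]] := lift_joins zau.
exists e; first by rewrite phi_induced ea.
apply: (joins_cuts xev) => //.
by move: zZ; rewrite inE => /andP[_ /forallP/(_ x)]; rewrite xz eqxx.
Qed.

(** The genus grows with connected subcurves, and this one lies between two of genus two: the
    preimage of [A] and the whole curve. *)
Lemma preim_genus : arith_genus (@gen R X) (@phiV R X @^-1: W) = 2.
Proof.
apply/(connected_genus2 preim_connected).
have /(connected_genus2 A_conn) gA := A_genus.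
have /(connected_genus2 (Gam_connected hX)) gT := Gam_genus hX.
have /connectedP[A0 _] := A_conn; have /connectedP[W0 cW] := preim_connected.
have /connectedP[_ cT] := Gam_connected hX.
have := card_induced_growth cW (preimsetS _ AW) A0.
have := card_induced_growth cT (subsetT _) W0.
have le_gen (S S' : {set V}) : S \subset S' ->
    (\sum_(v in S) gen v <= \sum_(v in S') gen v)%N.
  move=> SS; rewrite [leqRHS](big_setID S) /= (setIidPr SS); exact: leq_addr.
have := le_gen _ _ (preimsetS (@phiV R X) AW).
have := le_gen _ _ (subsetT (@phiV R X @^-1: W)).
move: gA gT; clear; lia.
Qed.

(** Genus two upstairs and one edge less than vertices in the subtree [W] reduce
    [riemann_hurwitz_preim] to the number 6. *)
Lemma branch_count : (\sum_(u in W) br u + \sum_(a | cuts W a) edge_ram a = 6)%N.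
Proof.
have /(connected_genus2 preim_connected) g2 := preim_genus.
have W0 : W != set0 by apply: contraNneq genus2_neq0 => W0;
  rewrite -subset0 -W0.
have := card_induced_subtree GamT_cut_connected GamT_euler W_conn W0.
have := riemann_hurwitz_preim W; move: g2; clear; lia.
Qed.

End Larger.

End GenusTwo.

End Covers.

(** * Slopes of admissible functions and the restricted branch divisor *)

Section Special.
Variables (R : realType) (X : cover_data R).
Hypothesis hX : admissible_cover X.

Notation V := (vert (Gam X)).
Notation E := (edge (Gam X)).
Notation VT := (vert (GamT X)).
Notation ET := (edge (GamT X)).
Implicit Types (A K N W : {set VT}) (a : ET) (u x y : VT) (L : VT -> VT -> R).

(** Summing the defining equation over the complement of [K] leaves only the slope along the single
    cut edge. *)
Lemma admissible_slope u0 (f : VT -> R) K a x y : admissible_fun u0 f ->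
  cut_connected K -> (forall a', cuts K a' = (a' == a)) ->
  joins a x y -> x \in K -> y \notin K ->
  (f x - f y) / len a = (u0 \notin K)%:R + 1 - (\sum_(u in ~: K) br u)%:R / 2.
Proof.
move=> [_ divf] cK cutK xay xK yK.
have K0 : K != set0 by apply/set0Pn; exists x.
have cutKC a' : cuts (~: K) a' = (a' == a) by rewrite cutsC.
have : \sum_(u in ~: K) (Dprime u + diverg [set: ET] f u) =
    \sum_(u in ~: K) (u == u0)%:R by apply: eq_bigr => u _; rewrite divf.
rewrite big_split /= sum_diverg (eq_bigl _ _ cutKC) big_pred1_eq => sumf.
have -> : (f x - f y) / len a = ((src a \in ~: K)%:R - (tgt a \in ~: K)%:R) *
    ((f (tgt a) - f (src a)) / len a).
  case/orP: xay => /andP[/eqP-> /eqP->]; rewrite !in_setC xK yK /=.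
    by rewrite sub0r mulN1r -mulNr opprB.
  by rewrite subr0 mul1r.
(* The complement is a tree, so its valences, with the cut edge counted once, add up to twice its
   number of vertices minus 1. *)
have sumD : \sum_(u in ~: K) Dprime u = (\sum_(u in ~: K) br u)%:R / 2 - 1 :> R.
  rewrite /Dprime !big_split /= -mulr_suml -!natr_sum sum_valence.
  rewrite (eq_bigl _ _ cutKC) big_pred1_eq sumr_const.
  rewrite -(card_induced_side (GamT_cut_connected hX) (GamT_euler hX) cK K0 cutK).
  rewrite mul2n -addnn -mulr_natr !natrD; ring.
have sum1 : \sum_(u in ~: K) (u == u0)%:R = (u0 \notin K)%:R :> R.
  rewrite -natr_sum -in_setC -sum_eq_mem; congr (_%:R).
  by apply: eq_bigr => u _; rewrite eq_sym.
move: sumf; rewrite sumD sum1 => <-; ring.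
Qed.

Lemma brS_preim N u : u \in N -> brS (@phiV R X @^-1: N) u =
  (br u + \sum_(a | a \notin induced N) ((src a == u) + (tgt a == u)) * edge_ram a)%N.
Proof.
(* Extending the ramification by zero on the retained edges turns it into a sum over whole
   fibres. *)
move=> uN; pose F (e : E) := if phiE e \in induced N then 0%N else (ord e - 1)%N.
have sumF a : (\sum_(e : E | phiE e == a) F e =
    if a \in induced N then 0 else edge_ram a)%N.
  rewrite /F /edge_ram; case: ifP => aN.
    by rewrite big1 // => e /eqP->; rewrite aN.
  by apply: eq_bigr => e /eqP->; rewrite aN.
have cond (P : pred E) :
    (\sum_(e : E | (e \notin induced (@phiV R X @^-1: N)) && P e) (ord e - 1) =
     \sum_(e | P e) F e)%N.
  rewrite big_mkcondl; apply: eq_bigr => e _; rewrite (phi_induced hX) /F.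
  by case: ifP; case: ifP.
rewrite /brS; under eq_bigr => v _ do rewrite !cond.
rewrite (eq_bigl (mem (@phiV R X @^-1: [set u]))) => [|v]; last first.
  by rewrite /= !inE; case: eqP => [->|]; rewrite ?uN ?andbF.
rewrite !big_split /= (sum_src_preim hX) (sum_tgt_preim hX) sum_preim big_set1.
rewrite -(br_ram hX) -addnA; congr addn.
rewrite [X in (X + _)%N]big_mkcond [X in (_ + X)%N]big_mkcond -big_split.
rewrite [RHS]big_mkcond; apply: eq_bigr => a _; rewrite /= !in_set1 sumF.
rewrite mulnDl; case: (a \in induced N) => /=; first by do 2![case: ifP].
by case: (src a == u); case: (tgt a == u); rewrite ?mul0n ?mul1n.
Qed.

Lemma mem_preimV N (v : V) : (v \in @phiV R X @^-1: N) = (phiV v \in N).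
Proof. by rewrite inE. Qed.

Lemma imV_preim N : imV (@phiV R X @^-1: N) = N.
Proof.
apply/setP => u; apply/imsetP/idP => [[v]|uN]; first by rewrite inE => vN ->.
by have [v vu] := phiV_surj hX u; exists v; rewrite ?inE vu.
Qed.

Lemma imE_preim N : imE (@phiV R X @^-1: N) = induced N.
Proof.
apply/setP => a; apply/imsetP/idP => [[e]|aN].
  by rewrite (phi_induced hX) => eN ->.
by have [e ea] := phiE_surj hX a; exists e; rewrite ?(phi_induced hX) ea.
Qed.

Lemma DeltaoE L : Deltao L = @phiV R X @^-1: DeltaoT L.
Proof. by apply/setP => v; rewrite !inE. Qed.

Lemma boundaryTP L u : reflect
  (u \notin DeltaoT L /\ exists x a, x \in DeltaoT L /\ joins a x u)
  (u \in boundaryT L).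
Proof.
rewrite [X in reflect _ X]inE; apply: (iffP andP) => -[uA].
  by case/existsP=> x /andP[xA /existsP[a xau]]; split=> //; exists x, a.
case=> x [a [xA xau]]; split=> //.
by apply/existsP; exists x; rewrite xA; apply/existsP; exists a.
Qed.

(** Since edges lift at every vertex, taking the closure commutes with taking preimages. *)
Lemma Deltao_closureE L :
  Deltao_closure L = @phiV R X @^-1: (DeltaoT L :|: boundaryT L).
Proof.
apply/setP => v; rewrite /Deltao_closure DeltaoE in_setU !mem_preimV in_setU.
case: (boolP (phiV v \in DeltaoT L)) => //= vA; rewrite inE.
apply/existsP/boundaryTP => [[x /andP[xA /existsP[e xev]]]|[_ [x [a [xA xau]]]]].
  split=> //; exists (phiV x), (phiE e); split; last exact: phi_joins.
  by rewrite mem_preimV in xA.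
have [e [x' [xev _ xx]]] := lift_joins hX xau.
exists x'; rewrite mem_preimV xx xA; apply/existsP; by exists e.
Qed.

Lemma lamT_ge0 L u : 0 <= lamT L u.
Proof. exact: bigmax_ge_id. Qed.

Lemma le_lamT L u0 u : u0 \in orig X -> L u0 u <= lamT L u.
Proof. by move=> ?; apply: le_bigmax_cond. Qed.

Lemma lamT0 L u : u \notin DeltaoT L -> lamT L u = 0.
Proof.
by rewrite inE -leNgt => le0; apply/eqP; rewrite eq_le le0 lamT_ge0.
Qed.

Lemma adapted_joins L a x y (t : R) : adapted L -> joins a x y -> 0 <= t <= 1 ->
  \big[Num.max/0]_(u0 in orig X) ((1 - t) * L u0 x + t * L u0 y)
  = (1 - t) * lamT L x + t * lamT L y.
Proof.
move=> adL /orP[] /andP[/eqP <- /eqP <-] t01; first exact: adL.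
have t01' : 0 <= 1 - t <= 1 by lra.
have := adL a (1 - t) t01'; rewrite subKr [RHS]addrC => <-.
by apply: eq_bigr => u0 _; rewrite addrC.
Qed.

(** * The complement of the locus where lambda is positive *)

Section Lambda.
Variable L : VT -> VT -> R.
Hypotheses (hL : normalized_family L) (hadapted : adapted L).
Hypothesis hconn : connected (Deltao L).
Hypothesis hgenus : arith_genus (@gen R X) (Deltao L) = 2.
Notation A := (DeltaoT L).
Notation N := (DeltaoT L :|: boundaryT L).

Lemma DeltaoT_preim_connected : connected (@phiV R X @^-1: A).
Proof. by rewrite -DeltaoE. Qed.

Lemma DeltaoT_preim_genus : arith_genus (@gen R X) (@phiV R X @^-1: A) = 2.
Proof. by rewrite -DeltaoE. Qed.

Let pA_conn := DeltaoT_preim_connected.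
Let pA_genus := DeltaoT_preim_genus.
Let A_conn := genus2_cut_connected hX pA_conn.
Let A_neq0 := genus2_neq0 pA_conn.

(** By [branch_count], all but [edge_ram a] of the six branch points lie in [K]. *)
Lemma branch_side K a : cut_connected K -> A \subset K ->
  (forall a', cuts K a' = (a' == a)) ->
  (\sum_(u in ~: K) br u = edge_ram a)%N.
Proof.
move=> cK AK cutK; have := branch_count hX pA_conn pA_genus cK AK.
rewrite (eq_bigl _ _ cutK) big_pred1_eq -(br_six hX).
rewrite [X in _ = X -> _](bigID (mem K)) /=.
rewrite [X in _ = (_ + X)%N -> _](eq_bigl (mem (~: K))) => [|u];
  last by rewrite /= inE.
by move=> /addnI.
Qed.

Lemma side_of y : y \notin A -> exists K a x,
  [/\ [/\ cut_connected K, A \subset K & y \notin K], x \in K, joins a x y &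
      forall a', cuts K a' = (a' == a)].
Proof. exact: tree_side (GamT_cut_connected hX) (GamT_euler hX) _ _ A_conn A_neq0. Qed.

(* A branch of the tree outside of {lambda_T > 0} carries at most one branch
   point, hence every admissible function increases towards {lambda_T > 0}. *)
Lemma increase_towards y : y \notin A -> exists a x, joins a x y /\
  forall u0, u0 \in orig X -> L u0 y < L u0 x.
Proof.
move=> yA; have [K [a [x [[cK AK yK] xK xay cutK]]]] := side_of yA.
exists a, x; split=> // u0 /hL[adm _].
have := admissible_slope adm cK cutK xay xK yK.
rewrite (branch_side cK AK cutK) => slope.
have le1 : (edge_ram a)%:R <= 1 :> R by rewrite lern1 edge_ram_le1.
have : 0 < (L u0 x - L u0 y) / len a.
  by have := ler0n R (u0 \notin K); rewrite slope; lra.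
by rewrite pmulr_lgt0 ?invr_gt0 ?len_gt0 // subr_gt0.
Qed.

(** Normalization gives a zero of [L u0] at a vertex of positive weight. No admissible function is
    positive there, so it lies off [A], where [L u0] is at most zero: it is a maximum off [A]. *)
Lemma admissible_zero u0 : u0 \in orig X ->
  exists2 u, u \in boundaryT L & (0 < wtT u)%N /\ L u0 u = 0.
Proof.
move=> u0o; have [_ [pos_wt0 wt_ge1]] := hL u0o.
have [w w0 wtw] : exists2 w : V, 0 <= L u0 (phiV w) & (0 < wt w)%N.
  have : [exists w : V, (0 <= L u0 (phiV w)) && (0 < wt w)%N].
    apply: contraT => /existsPn none; move: wt_ge1; rewrite big1 // => w w0.
    by have := none w; rewrite w0 lt0n negbK => /eqP.
  by case/existsP=> w /andP[]; exists w.
have Lw0 : L u0 (phiV w) = 0.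
  by apply/eqP; rewrite eq_le w0 andbT leNgt; apply/negP => /pos_wt0 wt0;
    rewrite wt0 in wtw.
have wA : phiV w \notin A.
  rewrite inE -leNgt; apply: bigmax_le => // u1 /hL[_ [pos1 _]].
  by rewrite leNgt; apply/negP => /pos1 wt0; rewrite wt0 in wtw.
have [z zA maxz] : exists2 z, z \notin A & forall y, y \notin A -> L u0 y <= L u0 z.
  by case: (@arg_maxP _ _ _ (phiV w) (fun y => y \notin A) (L u0) wA) => z;
    exists z.
(* A maximum off [A] has a neighbour with a larger value, which must then lie in [A]. *)
have toA y : y \notin A -> L u0 z <= L u0 y -> y \in boundaryT L.
  move=> yA zy; apply/boundaryTP; split=> //.
  have [a [x [xay /(_ _ u0o) yx]]] := increase_towards yA; exists x, a;
    split=> //.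
  by apply/negPn/negP => /maxz; rewrite leNgt (le_lt_trans zy yx).
have Lz0 : L u0 z <= 0 by rewrite -(lamT0 zA) le_lamT.
exists (phiV w); first by apply: toA; rewrite ?Lw0.
split=> //; apply: (leq_trans wtw); rewrite /wtT (bigD1 w) //=; exact: leq_addr.
Qed.

(** * A single boundary vertex of positive weight *)

Section UniqueWeight.
Variable v : VT.
Hypotheses (hv : v \in boundaryT L) (hwv : (0 < wtT v)%N).
Hypothesis huniq : forall u, u \in boundaryT L -> (0 < wtT u)%N -> u = v.

Lemma weighted_orig : v \in orig X.
Proof.
by apply: contraT => /(subdivision hX)[_ _ wt0]; move: hwv; rewrite wt0.
Qed.

Lemma admissible_at_v u0 : u0 \in orig X -> L u0 v = 0.
Proof.
by move=> /admissible_zero[u ub [wu <-]]; rewrite (huniq ub wu).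
Qed.

(** Both functions vanish at [v], and their difference has divisor [u0] minus [v], nonnegative away
    from [v]. *)
Lemma admissible_le u0 u : u0 \in orig X -> L u0 u <= L v u.
Proof.
move=> u0o; have [[_ div0] _] := hL u0o; have [[_ divv] _] := hL weighted_orig.
rewrite -subr_le0 -(subrr 0) -{1}(admissible_at_v u0o) -(admissible_at_v weighted_orig).
apply: (maximum_principle (f := fun x => L u0 x - L v x) (GamT_cut_connected hX)).
move=> x xv; rewrite divergB; have := div0 x; have := divv x;
  rewrite (negbTE xv) /=.
by have := ler0n R (x == u0); lra.
Qed.

Lemma lamTE u : lamT L u = Num.max 0 (L v u).
Proof.
apply/eqP; rewrite eq_le; apply/andP; split.
  apply: bigmax_le => [|u0 u0o]; first by rewrite le_max lexx.
  by rewrite le_max admissible_le ?orbT.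
by rewrite ge_max lamT_ge0 le_lamT ?weighted_orig.
Qed.

Lemma lamT_DeltaoT u : u \in A -> lamT L u = L v u.
Proof. by rewrite inE lamTE lt_max ltxx /= => /ltW/max_idPr. Qed.

(** If [L v] were negative at [u], it would change sign along an edge from [A], giving the maximum a
    kink that an adapted model excludes. *)
Lemma lamT_boundary u : u \in boundaryT L -> lamT L u = L v u.
Proof.
move=> /boundaryTP[uA [x [a [xA xau]]]].
have Lu0 : L v u <= 0 by rewrite -(lamT0 uA) le_lamT ?weighted_orig.
rewrite (lamT0 uA); apply/esym/eqP; rewrite eq_le Lu0 leNgt; apply/negP => Lu.
have Lx : 0 < L v x by rewrite -lamT_DeltaoT //; move: xA; rewrite inE.
(* The parameter at which [L v] vanishes on the edge from [x] to [u]. *)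
pose t := L v x / (L v x - L v u).
have d0 : 0 < L v x - L v u by lra.
have t1 : (1 - t) * (L v x - L v u) = - L v u by rewrite /t; field; lra.
have tE : t * (L v x - L v u) = L v x by rewrite /t; field; lra.
have t_lt1 : 0 < 1 - t by rewrite -(pmulr_lgt0 _ d0) t1; lra.
have t_gt0 : 0 < t by rewrite -(pmulr_lgt0 _ d0) tE.
have t01 : 0 <= t <= 1 by lra.
have zero : (1 - t) * L v x + t * L v u = 0 by rewrite /t; field; lra.
have := adapted_joins hadapted xau t01.
rewrite (lamT0 uA) mulr0 addr0 lamT_DeltaoT // => eq_max.
(* At this point every admissible function is bounded by [L v], which is zero, yet linearity makes
   their maximum positive. *)
have : (1 - t) * L v x <= 0.
  rewrite -eq_max; apply: bigmax_le => // u0 u0o; rewrite -zero.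
  by rewrite lerD // ler_wpM2l ?admissible_le // ltW.
by rewrite leNgt mulr_gt0.
Qed.

Lemma lamT_closure u : u \in N -> lamT L u = L v u.
Proof. by rewrite in_setU => /orP[/lamT_DeltaoT|/lamT_boundary]. Qed.

Lemma closure_cut_connected : cut_connected N.
Proof.
apply: (cut_connected_ext A_conn A_neq0 (subsetUl _ _)) => z.
by rewrite in_setU => /orP[->//|/boundaryTP[_ ?] _].
Qed.

(** The closure already has a connected preimage of genus two, so it is the minimal candidate. *)
Lemma is_DeltaE Delta : is_Delta L Delta -> Delta = @phiV R X @^-1: N.
Proof.
move=> [[clD _ _] minD]; apply/eqP;
  rewrite eqEsubset -Deltao_closureE clD andbT.
apply: minD; rewrite /genus_two_hull subxx Deltao_closureE; split=> //.
  exact: preim_connected pA_conn _ closure_cut_connected (subsetUl _ _).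
exact: preim_genus pA_conn pA_genus _ closure_cut_connected (subsetUl _ _).
Qed.

(** All edges at [u] stay in [N], so the divisor agrees with that of [L v] on the whole tree, which
    is concentrated at [v] outside [A]. *)
Lemma special_divisor_DeltaoT u : u \in A ->
  special_divisor (@phiV R X @^-1: N) (lamT L) u = 0.
Proof.
move=> uA; have uN : u \in N by rewrite in_setU uA.
have inN a : (src a == u) || (tgt a == u) -> a \in induced N.
  have nb x : joins a u x -> x \in N.
    move=> uax; rewrite in_setU; case: (boolP (x \in A)) => //= xA.
    by apply/boundaryTP; split=> //; exists u, a.
  case/orP=> /eqP au; rewrite inE au uN ?andbT /=; apply: nb.
    by rewrite /joins au !eqxx.
  by rewrite /joins au !eqxx orbT.
have outN a : a \notin induced N -> ((src a == u) = false) * ((tgt a == u) = false).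
  by move=> aN; split; apply: contraNF aN => au; apply: inN; rewrite au ?orbT.
rewrite /special_divisor imV_preim uN imE_preim /DprimeS imE_preim brS_preim //.
rewrite (big1 _ (fun a => a \notin induced N)); last first.
  by move=> a /outN[-> ->].
have [[_ divv] _] := hL weighted_orig; have := divv u.
have /boundaryTP[vA _] := hv.
have -> : (u == v) = false by apply: contraNF vA => /eqP<-.
rewrite /Dprime addn0 mulr0n => <-; congr (_ - _ + _ + _).
  congr (_%:R); rewrite !valenceE [RHS](bigID (mem (induced N))) /=.
  rewrite [X in (_ + X)%N]big1 ?addn0 => [|a /andP[_ /outN[-> ->]]//].
  by apply: eq_bigl => a; rewrite in_setT.
rewrite !divergE [RHS](bigID (mem (induced N))) /=.
rewrite [X in _ + X]big1 ?addr0 => [|a /andP[_ /outN[-> ->]]];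
  last by rewrite subrr mul0r.
apply: eq_big => a; first by rewrite in_setT.
by rewrite inE => /andP[sN tN]; rewrite !lamT_closure.
Qed.

(** In the closure [b] is a leaf, attached along [a]. Its restricted branch degree is [edge_ram a],
    which cancels against the same term in the slope of [L v]. *)
Lemma special_divisor_boundary b : b \in boundaryT L ->
  special_divisor (@phiV R X @^-1: N) (lamT L) b = (b == v)%:R.
Proof.
move=> bb; have /boundaryTP[bA [x0 [a0 [x0A x0ab]]]] := bb.
have bN : b \in N by rewrite in_setU bb orbT.
have [K [a [x [[cK AK bK] xK xab cutK]]]] := side_of bA.
(* Only [a] leaves [K], so it is the edge joining [b] to [A], and its inner end lies in [A]. *)
have ea : a0 = a.
  by apply/eqP; rewrite -cutK; apply: (joins_cuts x0ab) => //;
    apply: (subsetP AK).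
subst a0.
have neq_of (c d : VT) : c \in K -> d \notin K -> c != d.
  by move=> cK' dK; apply: contraNneq dK => <-.
have [ex _] := joins_cut_inj x0ab xab (subsetP AK x0 x0A) xK bK bK.
subst x0; have xN : x \in N by rewrite in_setU x0A.
have aN : a \in induced N := joins_induced xab xN bN.
(* Any other boundary vertex off [K] would also be reached from [A] through [a]. *)
have onlyb z : z \in N -> z \notin K -> z = b.
  rewrite in_setU => /orP[/(subsetP AK)->//|/boundaryTP[_ [y [a' [yA yaz]]]]] zK.
  have yK := subsetP AK y yA.
  have /eqP ea' : a' == a by rewrite -cutK; apply: (joins_cuts yaz).
  by rewrite ea' in yaz; have [] := joins_cut_inj yaz xab yK xK zK bK.
have incb a' : a' \in induced N -> a' != a -> ((src a' == b) = false) * ((tgt a' == b) = false).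
  rewrite inE => /andP[sN tN]; rewrite -cutK /cuts => cut'.
  have := no_loop (GamT_cut_connected hX) (GamT_euler hX) a'.
  case: (boolP (src a' \in K)) cut' => sK;
    case: (boolP (tgt a' \in K)) => tK // _.
    by split; apply/negbTE/neq_of.
  by rewrite (onlyb _ sN sK) (onlyb _ tN tK) eqxx.
have ends : (((src a == b) + (tgt a == b))%N = 1%N) *
    (((src a == b)%:R - (tgt a == b)%:R) * ((L v (tgt a) - L v (src a)) / len a)
      = (L v x - L v b) / len a).
  have xb := negbTE (neq_of _ _ xK bK).
  case/orP: xab => /andP[/eqP-> /eqP->]; rewrite xb eqxx; split=> //=.
    by rewrite sub0r mulN1r -mulNr opprB.
  by rewrite subr0 mul1r.
have val1 : valence (induced N) b = 1%N.
  rewrite valenceE (bigD1 a) //= ends.1 big1 ?addn0 // => a' /andP[a'N a'a].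
  by have [-> ->] := incb a' a'N a'a.
(* Comparing [branch_count] for [K] and for [b |: K] isolates the contribution of [b]. *)
have brb : brS (@phiV R X @^-1: N) b = edge_ram a.
  have bKc : cut_connected (b |: K) := cut_connected_setU1 cK xK xab.
  have AbK : A \subset b |: K := subset_trans AK (subsetUr _ _).
  have := branch_count hX pA_conn pA_genus bKc AbK.
  have := branch_count hX pA_conn pA_genus cK AK.
  rewrite (eq_bigl _ _ cutK) big_pred1_eq big_setU1 //= brS_preim //.
  (* The edges leaving [b |: K] are those at [b] other than [a], and these are exactly the edges at
     [b] cut off from [N]. *)
  have -> : (\sum_(a' | cuts (b |: K) a') edge_ram a' =
      \sum_(a' | a' \notin induced N)
        ((src a' == b) + (tgt a' == b)) * edge_ram a')%N.
    rewrite [LHS]big_mkcond [RHS]big_mkcond; apply: eq_bigr => a' _.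
    rewrite /cuts !in_setU1.
    case: (eqVneq a' a) => [->|a'a].
      by rewrite aN; case/orP: xab => /andP[/eqP-> /eqP->];
        rewrite eqxx xK ?orbT.
    have cut' : (src a' \in K) = (tgt a' \in K).
      by have := cutK a'; rewrite (negbTE a'a) /cuts; do 2![case: (_ \in K)].
    case: (boolP (a' \in induced N)) => a'N /=.
      by have [-> ->] := incb a' a'N a'a; rewrite cut' addbb.
    case: (boolP (src a' \in K)) cut' => sK tK.
      by rewrite -tK !(negbTE (neq_of _ _ _ bK)) // -tK.
    rewrite -tK !orbF; case: (eqVneq (src a') b) => [sb|_];
      case: (eqVneq (tgt a') b) => [tb|_] //=; rewrite ?mul0n ?mul1n //.
    by have := no_loop (GamT_cut_connected hX) (GamT_euler hX) a';
      rewrite sb tb eqxx.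
  clear; lia.
have div1 : diverg (induced N) (lamT L) b = (L v x - L v b) / len a.
  rewrite divergE (bigD1 a) //= big1 ?addr0 => [|a' /andP[a'N a'a]]; last first.
    by have [-> ->] := incb a' a'N a'a; rewrite subrr mul0r.
  rewrite -ends.2; move: aN; rewrite inE => /andP[sN tN].
  by rewrite !lamT_closure.
rewrite /special_divisor imV_preim bN imE_preim /DprimeS imE_preim val1 brb div1.
have [adm _] := hL weighted_orig.
rewrite (admissible_slope adm cK cutK xab xK bK) (branch_side cK AK cutK).
have -> : (b == v) = (v \notin K).
  apply/eqP/idP => [<-//|vK]; apply/esym/onlyb => //.
  by rewrite in_setU hv orbT.
ring.
Qed.

End UniqueWeight.

End Lambda.

End Special.

Theorem lemma3p24 (R : realType) (X : cover_data R)
    (hX : admissible_cover X)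
    (L : vert (GamT X) -> vert (GamT X) -> R)
    (hL : normalized_family L)
    (hadapted : adapted L)
    (hconn : connected (Deltao L))
    (hgenus : arith_genus (@gen R X) (Deltao L) = 2)
    (Delta : {set vert (Gam X)})
    (hDelta : is_Delta L Delta)
    (v : vert (GamT X))
    (hv : v \in boundaryT L)
    (hwv : (0 < wtT v)%N)
    (huniq : forall u : vert (GamT X),
        u \in boundaryT L -> (0 < wtT u)%N -> u = v) :
  special_points Delta (lamT L) = [set v].
Proof.
rewrite (is_DeltaE hX hconn hgenus hDelta); apply/setP => u;
  rewrite in_set1 inE.
case: (boolP (u \in boundaryT L)) => ub.
  rewrite (special_divisor_boundary hX hL hadapted hconn hgenus hv hwv huniq ub).
  by rewrite pnatr_eq0 eqb0 negbK.
have -> : (u == v) = false by apply: contraNF ub => /eqP->.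
case: (boolP (u \in DeltaoT L)) => uA.
  by rewrite (special_divisor_DeltaoT hX hL hadapted hconn hgenus hv hwv huniq uA) eqxx.
(* Outside the image of [Delta] the divisor is zero by convention. *)
by rewrite /special_divisor (imV_preim hX) in_setU (negbTE uA) (negbTE ub) eqxx.
Qed.
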